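(* Let $p$ be a prime and let $k\in\mathbb{N}$ be relatively prime to $p$. If $M, n\in\mathbb{N}$ satisfy $\gamma_{p^n}(k)\leq M$ and $M-1\mid p^n-1$, then \[ v(p,k)\leq 2(M-1)+\mathbf{1}_M(\gamma_{p^n}(k)). \]
   Context: Let $F$ be an algebraically closed field of characteristic $p>0$. For $k\in\mathbb{N}$, $v(p,k)$ denotes the smallest natural number $s$ such that every polynomial in $F[t]$ can be written as a sum of at most $s$ $k$-th powers of polynomials in $F[t]$ (with no restriction on the degrees of the polynomials being raised to the $k$-th power); if no such $s$ exists, $v(p,k)=\infty$. For an integer $q\geq 2$, if $k=k_1q^{a_1}+\cdots+k_Nq^{a_N}$ is the base-$q$ expansion of $k$ (with $0\le k_i<q$), then $\gamma_q(k)=k_1+\cdots+k_N$ is the sum of the base-$q$ digits of $k$. The indicator function is $\mathbf{1}_M(x)=1$ if $x=M$ and $\mathbf{1}_M(x)=0$ if $x\neq M$. *)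

(* Defs.v *)
From HB Require Import structures.
From mathcomp Require Import all_boot all_order all_algebra.
Set Implicit Arguments. Unset Strict Implicit. Unset Printing Implicit Defensive.
Import GRing.Theory.

(* gamma_q(k): sum of the base-q digits of k (meaningful for q >= 2).
   The i-th base-q digit of k is (k %/ q^i) %% q; for q >= 2 all digits
   of index > k vanish since q^i > k, so summing over i < k.+1 is exhaustive. *)
Definition digit_sum (q k : nat) : nat := \sum_(i < k.+1) ((k %/ q ^ i) %% q).

Definition ind (M x : nat) : nat := if x == M then 1 else 0.

(* Every polynomial of F[t] is a sum of at most s k-th powers of polynomials,
   i.e. the Waring number v(p,k) for F (of characteristic p) is <= s. *)
Definition waring_bound (F : closedFieldType) (k s : nat) : Prop :=
  forall f : {poly F}, exists g : seq {poly F},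
    (size g <= s)%N /\ f = (\sum_(h <- g) h ^+ k)%R.

(* Main.v *)
(* It suffices to write a polynomial as a sum of scaled K-th powers for some
   multiple K of k.  With q = p^n and o the totient of k, moving the digits of k
   from q^i (i > 0) to q^e, e = 1 + (o+1)(i-1), gives such a multiple
   K = sum_e q^e with the same digit sum, as q^e = q^i modulo k.  For b in F_q,
   (1 + b h)^K = prod_e (1 + b h^(q^e)), so with N = M - 1 a combination over the
   N-th roots of unity b extracts sum_e h^(q^e), up to a constant and, when the
   digit sum is M, a multiple of h^K.  Doing the same with c h, where c is fixed
   by the q^(o+1)-Frobenius but not by the q-Frobenius, multiplies the term of
   exponent q^0 by c and all the others by c^q, so a combination of the two
   families leaves a nonzero multiple of h; if h^K remains, one more power
   cancels it. *)
Require Import Defs.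
From mathcomp Require Import all_boot all_order all_algebra.
From mathcomp Require Import cyclic separable cyclotomic.
Set Implicit Arguments. Unset Strict Implicit. Unset Printing Implicit Defensive.
Import GRing.Theory.
Local Open Scope ring_scope.

(** * Roots of unity and their power sums *)

Lemma closed_field_prim_root (F : closedFieldType) (n : nat) :
  n%:R != 0 :> F -> exists z : F, n.-primitive_root z.
Proof.
move=> nF; have n_gt0 : (0 < n)%N by case: n nF => //; rewrite eqxx.
have [rs Drs] := closed_field_poly_normal ('X^n - 1 : {poly F}).
have lc1 : lead_coef ('X^n - 1 : {poly F}) = 1.
  by rewrite lead_coefXnsubC.
rewrite lc1 scale1r in Drs.
(* As [n] is nonzero in [F], ['X^n - 1] is separable and [rs] lists [n] distinct roots of unity. *)
have : has n.-primitive_root rs.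
  apply: has_prim_root => //.
  - apply/allP=> x x_rs; rewrite unity_rootE.
    have : root ('X^n - 1) x by rewrite Drs root_prod_XsubC.
    by rewrite rootE !hornerE subr_eq0.
  - by rewrite -separable_prod_XsubC -Drs separable_Xn_sub_1.
  - have := size_XnsubC (1 : F) n_gt0.
    by rewrite Drs size_prod_XsubC => -[->].
by case/hasP=> z _ zP; exists z.
Qed.

Lemma sum_prim_root_expr (F : fieldType) (n m : nat) (z : F) :
  n.-primitive_root z ->
  \sum_(i < n) z ^+ (i * m) = if (n %| m)%N then n%:R else 0.
Proof.
move=> zP; rewrite (prim_order_dvd zP).
have Dsum : \sum_(i < n) z ^+ (i * m) = \sum_(i < n) (z ^+ m) ^+ i.
  by apply: eq_bigr => i _; rewrite mulnC exprM.
rewrite {}Dsum; case: eqP => [->|/eqP zm].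
  by rewrite (eq_bigr (fun=> 1)) => [|i _]; rewrite ?expr1n // sumr_const card_ord.
apply: (mulfI (x := z ^+ m - 1)); first by rewrite subr_eq0.
by rewrite -subrX1 mulr0 exprAC (prim_expr_order zP) expr1n subrr.
Qed.

(** * Products of linear factors and extraction of their coefficients *)

Section LinearFactors.
Variable A : comNzRingType.
Implicit Types s : seq A.
Local Notation linprod s := (\prod_(a <- s) (1 + a%:P * 'X)).

Lemma size_linprod s : (size (linprod s) <= (size s).+1)%N.
Proof.
elim: s => [|a s IHs]; first by rewrite big_nil size_poly1.
rewrite big_cons /= (leq_trans (size_polyMleq _ _)) //.
have size_lin : (size (1 + a%:P * 'X)%R <= 2)%N.
  by rewrite addrC size_MXaddC; case: ifP => // _; rewrite ltnS size_polyC leq_b1.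
by rewrite -subn1 leq_subLR; exact: leq_add size_lin IHs.
Qed.

(** The recurrence of elementary symmetric functions; only those of degree 0, 1 and [size s] are
    needed. *)
Lemma coef_linprod_cons a s i :
  (linprod (a :: s))`_i.+1 = (linprod s)`_i.+1 + a * (linprod s)`_i.
Proof. by rewrite big_cons mulrDl mul1r coefD -mulrA coefCM coefXM. Qed.

Lemma coef0_linprod s : (linprod s)`_0 = 1.
Proof.
elim: s => [|a s IHs]; first by rewrite big_nil coef1.
by rewrite big_cons coef0M IHs coefD coefMX coef1 addr0 mulr1.
Qed.

Lemma coef1_linprod s : (linprod s)`_1 = \sum_(a <- s) a.
Proof.
elim: s => [|a s IHs]; first by rewrite !big_nil coef1.
by rewrite coef_linprod_cons IHs coef0_linprod big_cons mulr1 addrC.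
Qed.

Lemma coef_size_linprod s : (linprod s)`_(size s) = \prod_(a <- s) a.
Proof.
elim: s => [|a s IHs]; first by rewrite !big_nil coef1.
rewrite [size _]/= coef_linprod_cons IHs big_cons.
by rewrite nth_default ?add0r // size_linprod.
Qed.

End LinearFactors.

(* The roots of unity isolate the coefficients whose index is 1 modulo [N]:
   below [N + 2] these are 1 and [N + 1], and also 0 when [N = 1]. *)
Lemma sum_prim_root_horner (F : fieldType) (N : nat) (z : F)
    (P : {poly {poly F}}) :
  N.-primitive_root z -> (size P <= N.+2)%N ->
  \sum_(i < N) z ^+ (i * N.-1) *: P.[(z ^+ i)%:P] =
  N%:R *: (P`_1 + P`_N.+1 + (N == 1)%N%:R *: P`_0).
Proof.
move=> zP szP; have N_gt0 := prim_order_gt0 zP.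
have -> : \sum_(i < N) z ^+ (i * N.-1) *: P.[(z ^+ i)%:P] =
    \sum_(j < N.+2) (if (N %| N.-1 + j)%N then N%:R else 0) *: P`_j.
  transitivity (\sum_(i < N) \sum_(j < N.+2) z ^+ (i * (N.-1 + j)) *: P`_j).
    apply: eq_bigr => i _; rewrite (horner_coef_wide _ szP) scaler_sumr.
    apply: eq_bigr => j _; rewrite -rmorphXn /= mulrC mul_polyC scalerA.
    by rewrite -exprM -exprD -mulnDr.
  rewrite exchange_big; apply: eq_bigr => j _.
  by rewrite -scaler_suml sum_prim_root_expr.
have dvdS m : (N %| N.-1 + m.+1)%N = (N %| m)%N.
  by rewrite addnS -addSn prednK // dvdn_addr.
have dvd0 : (N %| N.-1 + 0)%N = (N == 1)%N.
  case: N N_gt0 {zP szP dvdS} => // -[|N] // _.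
  by rewrite addn0 gtnNdvd.
(* Indices 0, [N.+1] and 1 are split off in turn; those strictly between 1 and [N.+1] contribute
   nothing. *)
rewrite big_ord_recl dvd0 big_ord_recr /=.
rewrite (_ : bump 0 N = N.+1) // dvdS dvdnn.
rewrite (bigD1 (Ordinal N_gt0)) //= (_ : bump 0 0 = 1%N) // dvdS dvdn0.
rewrite big1 => [|i ne_i0]; last first.
  rewrite (_ : bump 0 i = i.+1) // dvdS gtnNdvd ?scale0r // lt0n.
  by apply: contra ne_i0 => /eqP i0; apply/eqP/val_inj.
rewrite addr0 !scalerDr [LHS]addrC; congr (_ + _).
by case: eqP => _ /=; rewrite ?scale1r // !scale0r scaler0.
Qed.

(** * Scaled powers and Frobenius factorization *)

Section Waring.
Variable F : closedFieldType.

Lemma closed_field_nth_root (k : nat) (a : F) :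
  (0 < k)%N -> exists r : F, r ^+ k = a.
Proof.
move=> k_gt0; have [|r] := closed_rootP ('X^k - a%:P : {poly F}) _.
  by rewrite size_XnsubC //; case: (k) k_gt0.
by rewrite rootE !hornerE subr_eq0 => /eqP <-; exists r.
Qed.

(** Scalars cost nothing: each has a [k]-th root in [F], which is absorbed into the base. *)
Lemma sum_scaled_powers (k K : nat) (s : seq (F * {poly F})) :
  (0 < k)%N -> (k %| K)%N ->
  exists g : seq {poly F},
    size g = size s /\ \sum_(u <- s) u.1 *: u.2 ^+ K = \sum_(h <- g) h ^+ k.
Proof.
move=> k_gt0 /dvdnP[m ->]; elim: s => [|[a x] s [g [sz_g Dg]]].
  by exists [::]; rewrite !big_nil.
have [r Dr] := closed_field_nth_root a k_gt0.
exists (r *: x ^+ m :: g); split; first by rewrite /= sz_g.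
by rewrite !big_cons Dg exprZn Dr exprM.
Qed.

Variables (p n : nat).
Hypothesis charFp : p \in [pchar F].
Local Notation q := (p ^ n)%N.

(** Raising to the power [q ^ e] is additive in characteristic [p] and fixes [b]. *)
Lemma expr_sum_pchar (b : F) (u : {poly F}) (E : seq nat) : b ^+ q = b ->
  (1 + b *: u) ^+ (\sum_(e <- E) q ^ e) =
  (\prod_(a <- [seq u ^+ (q ^ e) | e <- E]) (1 + a%:P * 'X)).[b%:P].
Proof.
move=> bq; rewrite horner_prod big_map; elim: E => [|e E IHE].
  by rewrite !big_nil.
rewrite !big_cons exprD IHE; congr (_ * _); rewrite !hornerE.
rewrite exprDn_pchar ?expr1n; last first.
  rewrite -expnM (eq_pnat _ (pcharf_eq _ (p := p))) ?pnatX ?pnat_id ?orbT //.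
  - exact: (pcharf_prime charFp).
  - by rewrite pchar_poly.
have -> : (b *: u) ^+ (q ^ e) = b *: u ^+ (q ^ e).
  rewrite exprZn; congr (_ *: _); elim: e => [|e IHe]; first by rewrite expr1.
  by rewrite expnS exprM bq.
by rewrite mulrC mul_polyC.
Qed.

(** The three terms are the coefficients of index 1, [N.+1] and 0 of the product of linear factors;
    its degree reaches [N.+1] only if [size E] does. *)
Lemma sum_family (N : nat) (z : F) (u : {poly F}) (E : seq nat) :
  N.-primitive_root z -> z ^+ q = z -> (size E <= N.+1)%N ->
  \sum_(i < N) z ^+ (i * N.-1) *: (1 + z ^+ i *: u) ^+ (\sum_(e <- E) q ^ e) =
  N%:R *: (\sum_(e <- E) u ^+ (q ^ e)
           + (size E == N.+1)%:R *: u ^+ (\sum_(e <- E) q ^ e)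
           + (N == 1)%N%:R%:P).
Proof.
move=> zP zq szE; set s := [seq u ^+ (q ^ e) | e <- E].
have szs : size s = size E by rewrite size_map.
have ziq i : (z ^+ i) ^+ q = z ^+ i by rewrite exprAC zq.
transitivity (\sum_(i < N) z ^+ (i * N.-1) *:
    (\prod_(a <- s) (1 + a%:P * 'X)).[(z ^+ i)%:P]).
  by apply: eq_bigr => i _; congr (_ *: _); exact: expr_sum_pchar.
rewrite (sum_prim_root_horner zP); last first.
  by rewrite (leq_trans (size_linprod _)) // szs.
rewrite coef1_linprod coef0_linprod big_map alg_polyC; congr (_ *: (_ + _ + _)).
case: (eqVneq (size E) N.+1) => [szEN | neE].
  rewrite -szEN -{1}szs coef_size_linprod big_map scale1r.
  by rewrite (big_morph _ (exprD u) (expr0 u)).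
rewrite scale0r nth_default // (leq_trans (size_linprod _)) // szs.
by rewrite ltn_neqAle neE.
Qed.

End Waring.

(** * Base-[q] digits and their relocation *)

Lemma digit_expansion (q k m : nat) :
  k = (\sum_(i < m) (k %/ q ^ i) %% q * q ^ i + k %/ q ^ m * q ^ m)%N.
Proof.
elim: m => [|m IHm]; first by rewrite big_ord0 divn1 muln1.
rewrite big_ord_recr /= {1}IHm -addnA; congr addn.
by rewrite {1}(divn_eq (k %/ q ^ m) q) -divnMA mulnDl addnC -mulnA -expnS -expnSr.
Qed.

(* [spread o i = i] modulo [o], so [q ^ spread o i = q ^ i] modulo [k] when
   [o] is the totient of [k]; modulo [o + 1] it is 1, except at [i = 0]. *)
Definition spread (o i : nat) : nat := if i is j.+1 then (1 + o.+1 * j)%N else 0.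

(** A digit [d] at position [i] is encoded as [d] copies of the new exponent, so the length is the
    digit sum. *)
Definition spread_digits (o q k : nat) : seq nat :=
  flatten [seq nseq ((k %/ q ^ i) %% q) (spread o i) | i <- iota 0 k.+1].

Lemma big_spread_digits (R : Type) (idx : R) (op : Monoid.law idx)
    (o q k : nat) (f : nat -> R) :
  \big[op/idx]_(e <- spread_digits o q k) f e =
  \big[op/idx]_(i < k.+1)
    iter ((k %/ q ^ i) %% q) (op (f (spread o i))) idx.
Proof.
rewrite /spread_digits big_flatten big_map -(big_mkord xpredT
  (fun i => iter ((k %/ q ^ i) %% q) (op (f (spread o i))) idx)).
by rewrite /index_iota subn0; apply: eq_bigr => i _; rewrite big_nseq.
Qed.

Lemma size_spread_digits (o q k : nat) :
  size (spread_digits o q k) = digit_sum q k.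
Proof.
rewrite -sum1_size big_spread_digits /digit_sum.
by apply: eq_bigr => i _; rewrite iter_addn_0 mul1n.
Qed.

Lemma dvdn_spread_digits (q k : nat) : (1 < q)%N -> coprime q k ->
  (k %| \sum_(e <- spread_digits (totient k) q k) q ^ e)%N.
Proof.
move=> q_gt1 co_qk; set o := totient k.
(* For [i = j.+1] the excess exponent is [o * j], removed by Euler's theorem. *)
have spread_mod i : q ^ spread o i = q ^ i %[mod k].
  case: i => // j; rewrite /= mulSn addnA add1n expnD expnM -modnMmr -modnXm.
  by rewrite (Euler_exp_totient co_qk) modnXm exp1n modnMmr muln1.
have Dk : k = (\sum_(i < k.+1) (k %/ q ^ i) %% q * q ^ i)%N.
  rewrite {1}(digit_expansion q k k.+1) [X in (_ + X * _)%N]divn_small ?addn0 //.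
  by rewrite (ltn_trans (ltnSn k)) // ltn_expl.
rewrite /dvdn; suff -> : (\sum_(e <- spread_digits o q k) q ^ e =
    \sum_(i < k.+1) (k %/ q ^ i) %% q * q ^ i %[mod k])%N by rewrite -Dk modnn.
rewrite big_spread_digits -modn_summ -[RHS]modn_summ; congr (_ %% _)%N.
by apply: eq_bigr => i _; rewrite iter_addn_0 mulnC -modnMmr spread_mod modnMmr.
Qed.

(** At positions [i > 0], [c ^+ (q ^ e)] is [c ^+ q], so only the [k %% q] copies of exponent 0
    survive. *)
Lemma sum_spread_digits (F : fieldType) (o q k : nat) (c : F) (u : {poly F}) :
  c ^+ (q ^ o.+1) = c ->
  \sum_(e <- spread_digits o q k) (c ^+ q - c ^+ (q ^ e)) *: u ^+ (q ^ e) =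
  ((c ^+ q - c) * (k %% q)%:R) *: u.
Proof.
move=> cQ; rewrite big_spread_digits big_ord_recl big1 => [|i _].
  by rewrite /= divn1 iter_addr addr0 !expr1 scalerMnl mulr_natr addr0.
have cQj j : c ^+ ((q ^ o.+1) ^ j) = c.
  by elim: j => // j IHj; rewrite expnS exprM cQ.
by rewrite iter_addr addr0 /= add0n expnD expnM expn1 mulnC exprM cQj subrr scale0r mul0rn.
Qed.

Theorem theorem1 (F : closedFieldType) (p k M n : nat) :
  prime p -> (p \in [pchar F]%R) -> coprime k p -> (0 < n)%N ->
  (digit_sum (p ^ n) k <= M)%N -> (M - 1 %| p ^ n - 1)%N ->
  waring_bound F k (2 * (M - 1) + ind M (digit_sum (p ^ n) k)).
Proof.
move=> p_pr charFp co_kp n_gt0 le_dsM dvd_Mq.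
set q := (p ^ n)%N in le_dsM dvd_Mq *.
have q_gt1 : (1 < q)%N by rewrite -(exp1n n) ltn_exp2r // prime_gt1.
have p_dvd_q : (p %| q)%N by rewrite dvdn_exp.
have k_gt0 : (0 < k)%N.
  by case: (posnP k) co_kp p_pr => // ->; rewrite /coprime gcd0n => /eqP->.
have co_qk : coprime q k by rewrite coprime_sym coprimeXr.
(* For [M = 0] the truncated [M - 1] is 0, which does not divide [q - 1 > 0]. *)
have [N DM] : exists N, M = N.+1.
  case: (M) dvd_Mq => [|N _]; last by exists N.
  by rewrite dvd0n subn_eq0 leqNgt q_gt1.
move: le_dsM dvd_Mq; rewrite {}DM subSS subn0 => le_ds dvd_Nq.
set o := totient k; set E := spread_digits o q k.
set K := (\sum_(e <- E) q ^ e)%N.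
have szE : size E = digit_sum q k := size_spread_digits o q k.
have dvd_kK : (k %| K)%N := dvdn_spread_digits q_gt1 co_qk.
(* Its value in [F] is -1, since [p] divides [q]. *)
have qXsub1_neq0 j : (0 < j)%N -> (q ^ j - 1)%:R != 0 :> F.
  move=> j_gt0; rewrite natrB; last by rewrite expn_gt0 ltnW.
  have /eqP-> : (q ^ j)%:R == 0 :> F.
    by rewrite -(dvdn_pcharf charFp) (dvdn_trans p_dvd_q) // dvdn_exp.
  by rewrite sub0r oppr_eq0 oner_eq0.
have N_neq0 : N%:R != 0 :> F.
  have := qXsub1_neq0 1%N isT; apply: contra => /eqP N0.
  by rewrite expn1; case/dvdnP: dvd_Nq => m ->; rewrite natrM N0 mulr0.
have [z zP] := closed_field_prim_root N_neq0.
have zq : z ^+ q = z.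
  rewrite -[q](subnK (ltnW q_gt1)) exprD expr1; case/dvdnP: dvd_Nq => m ->.
  by rewrite mulnC exprM (prim_expr_order zP) expr1n mul1r.
(* The order [q ^ o.+1 - 1] exceeds [q - 1] because [o > 0], hence [c ^+ q != c]. *)
have [c cP] := closed_field_prim_root (qXsub1_neq0 o.+1 isT).
have c_neq0 : c != 0.
  apply/eqP=> c0; have := prim_expr_order cP.
  rewrite c0 expr0n (gtn_eqF (prim_order_gt0 cP)) => /esym/eqP.
  by rewrite oner_eq0.
have cQ : c ^+ (q ^ o.+1) = c.
  have Q_gt0 : (0 < q ^ o.+1)%N by rewrite expn_gt0 ltnW.
  by rewrite -[X in c ^+ X](subnK Q_gt0) exprD expr1 (prim_expr_order cP) mul1r.
have cq : c ^+ q - c != 0.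
  have o_gt0 : (0 < o)%N by rewrite totient_gt0.
  have -> : c ^+ q - c = (c ^+ (q - 1) - 1) * c.
    by rewrite mulrBl mul1r -exprSr subn1 prednK // ltnW.
  rewrite mulf_neq0 // subr_eq0 -(prim_order_dvd cP) gtnNdvd //.
    by rewrite subn_gt0.
  by rewrite ltn_sub2r ?(ltn_trans q_gt1) // -{1}[q]expn1 ltn_exp2l ?ltnS.
have kq_neq0 : (k %% q)%:R != 0 :> F.
  rewrite -(dvdn_pcharf charFp) /dvdn modn_dvdm // -/(dvdn p k).
  by rewrite -prime_coprime // coprime_sym.
have coef_neq0 : (c ^+ q - c) * (k %% q)%:R != 0 by rewrite mulf_neq0.
move=> f.
pose top : {poly F} -> {poly F} := fun h =>
  (size E == N.+1)%:R *: ((c ^+ q - c ^+ K) *: h ^+ K).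
pose cst : {poly F} := (c ^+ q - 1) *: (N == 1)%N%:R%:P.
(* The sum over [c h] cancels every additive term but the one in degree 1. *)
have two_families h :
    \sum_(i < N) (z ^+ (i * N.-1) * c ^+ q) *: (1 + z ^+ i *: h) ^+ K
    + \sum_(i < N) (- z ^+ (i * N.-1)) *: (1 + z ^+ i *: (c *: h)) ^+ K =
    N%:R *: (((c ^+ q - c) * (k %% q)%:R) *: h + top h + cst).
  have le_szE : (size E <= N.+1)%N by rewrite szE.
  transitivity (c ^+ q *:
      \sum_(i < N) z ^+ (i * N.-1) *: (1 + z ^+ i *: h) ^+ K
    - \sum_(i < N) z ^+ (i * N.-1) *: (1 + z ^+ i *: (c *: h)) ^+ K).
    rewrite scaler_sumr -sumrN; congr (_ + _); apply: eq_bigr => i _.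
      by rewrite scalerA mulrC.
    by rewrite scaleNr.
  rewrite !(sum_family charFp _ zP zq le_szE) -(sum_spread_digits _ _ cQ) -/E.
  rewrite scalerA mulrC -scalerA -scalerBr; congr (_ *: _).
  rewrite !scalerDr !opprD addrACA [X in X + _ = _]addrACA; congr (_ + _ + _).
  - rewrite scaler_sumr -sumrB; apply: eq_bigr => e _.
    by rewrite exprZn scalerBl.
  - rewrite /top exprZn scalerBl scalerBr !scalerA.
    by congr (_ *: _ - _); rewrite mulrC.
  - by rewrite /cst scalerBl scale1r.
(* Solves the affine part for [f], leaving only [top h] to cancel. *)
pose h := ((c ^+ q - c) * (k %% q)%:R)^-1 *: (N%:R^-1 *: f - cst).
have Df : f = N%:R *: (((c ^+ q - c) * (k %% q)%:R) *: h + top h + cst)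
              - N%:R *: top h.
  rewrite -scalerBr addrAC addrK /h scalerA mulfV // scale1r subrK.
  by rewrite scalerA mulfV // scale1r.
(* Two families of [N] powers, and one more cancelling [top h] when the digit sum is [N.+1]. *)
pose s : seq (F * {poly F}) :=
  [seq (z ^+ (val i * N.-1) * c ^+ q, 1 + z ^+ val i *: h) | i <- index_enum 'I_N] ++
  [seq (- z ^+ (val i * N.-1), 1 + z ^+ val i *: (c *: h)) | i <- index_enum 'I_N] ++
  nseq (ind N.+1 (digit_sum q k)) (- N%:R * (c ^+ q - c ^+ K), h).
have [g [szg Dg]] := sum_scaled_powers s k_gt0 dvd_kK.
exists g; split.
  have sz_ord : size (index_enum 'I_N) = N
    by rewrite -sum1_size big_const_ord iter_addn_0 mul1n.
  by rewrite szg !size_cat !size_map size_nseq sz_ord mul2n -addnn addnA.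
rewrite -Dg !big_cat !big_map /= addrA two_families {1}Df.
congr (_ + _); rewrite big_nseq /top szE /ind; case: eqP => _ /=.
  by rewrite addr0 scale1r scalerA mulNr scaleNr.
by rewrite scale0r scaler0 oppr0.
Qed.
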